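(* Let $\Omega_n\subset\mathbb{R}^3$ be a nonempty domain, and call $(\mu_n,D_n,\Gamma_n,u_n)$ admissible if $\mu_n,D_n,\Gamma_n>0$ are constants and $u_n\in C^\infty(\Omega_n)$ is a positive bounded function with $D_n\Delta u_n-\mu_n u_n=0$ in $\Omega_n$; the associated photoacoustic data is $\mathcal{H}_n=\Gamma_n\mu_n u_n$. (a) The constants $(\mu_n,D_n,\Gamma_n)$ are uniquely determined by $\mathcal{H}_n$ together with one of the pairs $(\mu_n,\Gamma_n)$ or $(D_n,\Gamma_n)$. That is, if two admissible quadruples $(\mu_n,D_n,\Gamma_n,u_n)$ and $(\tilde\mu_n,\tilde D_n,\tilde\Gamma_n,\tilde u_n)$ have the same data, $\Gamma_n\mu_n u_n=\tilde\Gamma_n\tilde\mu_n\tilde u_n$ in $\Omega_n$, and either $(\mu_n,\Gamma_n)=(\tilde\mu_n,\tilde\Gamma_n)$ or $(D_n,\Gamma_n)=(\tilde D_n,\tilde\Gamma_n)$, then $(\mu_n,D_n,\Gamma_n)=(\tilde\mu_n,\tilde D_n,\tilde\Gamma_n)$. (b) If in addition to $\mathcal{H}_n$ the value $u_n(x)$ is known for some $x\in\Omega_n$, then knowing one of the three constants suffices. That is, if two admissible quadruples have the same data, $u_n(x)=\tilde u_n(x)$ for some $x\in\Omega_n$, and at least one of $\mu_n=\tilde\mu_n$, $D_n=\tilde D_n$, $\Gamma_n=\tilde\Gamma_n$ holds, then $(\mu_n,D_n,\Gamma_n)=(\tilde\mu_n,\tilde D_n,\tilde\Gamma_n)$. (c)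 If, in addition to $\mathcal{H}_n$, only one of the parameters $\mu_n,D_n,\Gamma_n$, or only the function $u_n$, or only the pair $(\mu_n,D_n)$ is known, then $(\mu_n,D_n,\Gamma_n)$ is not uniquely determined. That is, for every admissible quadruple $(\mu_n,D_n,\Gamma_n,u_n)$ and for each of the five choices of known quantity $\mu_n$; $D_n$; $\Gamma_n$; $u_n$; $(\mu_n,D_n)$, there is an admissible quadruple $(\tilde\mu_n,\tilde D_n,\tilde\Gamma_n,\tilde u_n)$ with the same data and the same value of the known quantity, but with $(\tilde\mu_n,\tilde D_n,\tilde\Gamma_n)\neq(\mu_n,D_n,\Gamma_n)$.
   Context: The setting is a single subregion $\Omega_n$ on which the absorption coefficient $\mu_n$, diffusion coefficient $D_n$ and Grüneisen coefficient $\Gamma_n$ are constant, and $u_n$ is the (strictly positive, bounded) restriction of the fluence to $\Omega_n$. All notions used are defined in the claim. *)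

(* Defs.v *)
From mathcomp Require Import all_boot all_order all_algebra.
From mathcomp Require Import all_classical all_reals all_analysis.
Set Implicit Arguments.
Unset Strict Implicit.
Unset Printing Implicit Defensive.
Import Order.TTheory GRing.Theory Num.Theory.
Import numFieldNormedType.Exports.
Local Open Scope classical_set_scope.
Local Open Scope ring_scope.

(* A function on a domain W of R^n is encoded as a total function on 'rV[R]_n.
   Its values outside W are irrelevant: W is open, every condition below is
   imposed only at points of W, and partial derivatives at a point of W depend
   only on the values near that point. *)

Definition is_domain {R : realType} {n : nat} (W : set 'rV[R]_n) : Prop :=
  open W /\ connected W.

Definition partial {R : realType} {n : nat} (i : 'I_n) (f : 'rV[R]_n -> R) :
    'rV[R]_n -> R :=
  fun x => 'D_(delta_mx 0 i) f x.

Definition iter_partial {R : realType} {n : nat} (s : seq 'I_n)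
    (f : 'rV[R]_n -> R) : 'rV[R]_n -> R :=
  foldr partial f s.

(* f is of class C^oo on the open set W: the iterated partial derivatives of
   every order (order 0 included) exist and are continuous at each point of W.
   'D_v is total, so the existence of each derivative is required explicitly. *)
Definition smooth_on {R : realType} {n : nat} (W : set 'rV[R]_n)
    (f : 'rV[R]_n -> R) : Prop :=
  forall (s : seq 'I_n) (x : 'rV[R]_n), W x ->
    {for x, continuous (iter_partial s f)} /\
    forall i : 'I_n, derivable (iter_partial s f) x (delta_mx 0 i).

Definition laplacian {R : realType} {n : nat} (f : 'rV[R]_n -> R) :
    'rV[R]_n -> R :=
  fun x => \sum_(i < n) partial i (partial i f) x.

Record admissible {R : realType} (W : set 'rV[R]_3) (mu D Gamma : R)
    (u : 'rV[R]_3 -> R) : Prop := Admissible {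
  absorption_gt0 : 0 < mu;
  diffusion_gt0 : 0 < D;
  gruneisen_gt0 : 0 < Gamma;
  fluence_smooth : smooth_on W u;
  fluence_gt0 : forall x, W x -> 0 < u x;
  fluence_bounded : [bounded u x | x in W];
  fluence_eq : forall x, W x -> D * laplacian u x - mu * u x = 0
}.

Definition photoacoustic_data {R : realType} (mu Gamma : R)
    (u : 'rV[R]_3 -> R) : 'rV[R]_3 -> R :=
  fun x => Gamma * mu * u x.

Definition eq_on {R : realType} (W : set 'rV[R]_3) (f g : 'rV[R]_3 -> R) :
    Prop :=
  forall x, W x -> f x = g x.

(* Main.v *)
(* If the data agree then u' = c u with a positive constant c, so D Δu = μ u
   and positivity of u give μ / D = μ' / D': the data only determine the
   products Γ μ u and the ratio μ / D, and conversely every rescaling of the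
   coefficients preserving these two is again admissible with the same data. *)

Require Import Defs.
From mathcomp Require Import all_boot all_order all_algebra.
From mathcomp Require Import all_classical all_reals all_analysis.
From mathcomp Require Import ring lra.
Import Order.TTheory GRing.Theory Num.Theory.
Import numFieldNormedType.Exports.
Local Open Scope classical_set_scope.
Local Open Scope ring_scope.

Section Scaling.
Set Implicit Arguments.
Unset Strict Implicit.
Context {R : realType} {n : nat} (W : set 'rV[R]_n).
Hypothesis Wopen : open W.
Implicit Types (f g : 'rV[R]_n -> R) (c : R).

(** Limits and derivatives at [x] see only the germ there, and openness of [W] turns an identity
    valid on [W] into an identity of germs. *)
Lemma near_eq_scale c f g x : (forall y, W y -> g y = c * f y) -> W x ->
  {near x, (c \*: f) =1 g}.
Proof.
move=> gE Wx; have : \forall y \near x, W y by exact: open_nbhs_nbhs.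
by apply: filterS => y Wy /=; rewrite gE.
Qed.

Lemma partial_scale c f g i x : (forall y, W y -> g y = c * f y) -> W x ->
  derivable f x (delta_mx 0 i) -> partial i g x = c * partial i f x.
Proof.
move=> gE Wx df; rewrite /partial -(near_eq_derive _ (near_eq_scale gE Wx)).
by rewrite deriveZ.
Qed.

Lemma iter_partial_scale c f g s x : smooth_on W f ->
  (forall y, W y -> g y = c * f y) -> W x ->
  iter_partial s g x = c * iter_partial s f x.
Proof.
move=> fs gE; elim: s x => [|i s IHs] x Wx; first exact: gE.
(* The induction hypothesis holds at every point of [W], so it is itself the scaling relation needed
   for one more derivative. *)
by apply: partial_scale => //; exact: (fs s x Wx).2.
Qed.

Lemma smooth_on_scale c f g : smooth_on W f ->
  (forall y, W y -> g y = c * f y) -> smooth_on W g.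
Proof.
move=> fs gE s x Wx; have [fc fd] := fs s x Wx.
have sE y : W y -> iter_partial s g y = c * iter_partial s f y.
  exact: iter_partial_scale.
have E := near_eq_scale sE Wx.
split=> [|i]; last by apply: (near_eq_derivable E); exact: derivableZ.
rewrite /prop_for /continuous_at (sE _ Wx).
apply: cvg_trans (near_eq_cvg E) _.
exact: cvgZ (cvg_cst c) fc.
Qed.

Lemma laplacian_scale c f g x : smooth_on W f ->
  (forall y, W y -> g y = c * f y) -> W x ->
  laplacian g x = c * laplacian f x.
Proof.
move=> fs gE Wx; rewrite /laplacian mulr_sumr; apply: eq_bigr => i _.
(* By computation, each summand is the iterated partial along [[:: i; i]]. *)
exact: (iter_partial_scale [:: i; i] fs gE Wx).
Qed.

End Scaling.

(** The equation is homogeneous in [(mu, D)] and linear in [u], and does not involve [Gamma]. This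
    three-parameter family supplies every counterexample of (c). *)
Lemma admissible_scale (R : realType) (W : set 'rV[R]_3) (mu D Gamma : R)
    (u : 'rV[R]_3 -> R) (a b c : R) :
  open W -> admissible W mu D Gamma u -> 0 < a -> 0 < b -> 0 < c ->
  admissible W (a * mu) (a * D) (b * Gamma) (fun x => c * u x).
Proof.
move=> Wopen [mu0 D0 G0 us u0 ub uE] a0 b0 c0.
set v := fun x => c * u x; have vE y : W y -> v y = c * u y by [].
split; rewrite ?mulr_gt0 //.
- exact: (smooth_on_scale Wopen us vE).
- by move=> x Wx; rewrite mulr_gt0 ?u0.
- have [M [Mr uM]] := ub.
  (* Boundedness reads: every [N > M] bounds [u]. If [N > c * M], then [N / c > M] bounds [u], hence
     [N] bounds [c * u]. *)
  exists (c * M); split; first exact: (realM (gtr0_real c0) Mr).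
  move=> N; rewrite mulrC -ltr_pdivlMr// => /uM uN x Wx /=.
  by rewrite normrM gtr0_norm// mulrC -ler_pdivlMr//; exact: uN.
- move=> x Wx; rewrite (laplacian_scale Wopen us vE Wx) vE//.
  by rewrite -[RHS](mulr0 (a * c)) -(uE _ Wx); ring.
Qed.

Lemma same_data_ratio (R : realType) (W : set 'rV[R]_3)
    (mu D Gamma mu' D' Gamma' : R) (u u' : 'rV[R]_3 -> R) :
  open W -> W !=set0 ->
  admissible W mu D Gamma u -> admissible W mu' D' Gamma' u' ->
  eq_on W (photoacoustic_data mu Gamma u) (photoacoustic_data mu' Gamma' u') ->
  mu * D' = mu' * D.
Proof.
move=> Wopen [x Wx] [mu0 D0 G0 us u0 _ uE] [mu0' D0' G0' _ u0' _ uE'] H.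
pose c := Gamma * mu / (Gamma' * mu').
have c0 : 0 < c by rewrite divr_gt0 ?mulr_gt0.
have u'E y : W y -> u' y = c * u y.
  move=> Wy; apply: (mulfI (lt0r_neq0 (mulr_gt0 G0' mu0'))).
  rewrite -[LHS](H y Wy) /photoacoustic_data /c; field.
  by rewrite !lt0r_neq0.
have := uE' x Wx; rewrite (laplacian_scale Wopen us u'E Wx) u'E// => E'.
(* After multiplication by [c * u x], the two equations at [x] turn both sides into
   [c * D * D' * laplacian u x]. *)
apply: (mulfI (lt0r_neq0 (mulr_gt0 c0 (u0 x Wx)))).
have -> : c * u x * (mu * D') = c * D' * (mu * u x) by ring.
rewrite -(subr0_eq (uE x Wx)).
have -> : c * u x * (mu' * D) = D * (mu' * (c * u x)) by ring.
by rewrite -(subr0_eq E'); ring.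
Qed.

Theorem proposition3 (R : realType) (W : set 'rV[R]_3)
    (W_domain : is_domain W) (W_neq0 : W !=set0) :
  (* (a) *)
  (forall (mu D Gamma : R) (u : 'rV[R]_3 -> R)
          (mu' D' Gamma' : R) (u' : 'rV[R]_3 -> R),
     admissible W mu D Gamma u -> admissible W mu' D' Gamma' u' ->
     eq_on W (photoacoustic_data mu Gamma u) (photoacoustic_data mu' Gamma' u') ->
     (mu, Gamma) = (mu', Gamma') \/ (D, Gamma) = (D', Gamma') ->
     (mu, D, Gamma) = (mu', D', Gamma'))
  /\
  (* (b) *)
  (forall (mu D Gamma : R) (u : 'rV[R]_3 -> R)
          (mu' D' Gamma' : R) (u' : 'rV[R]_3 -> R),
     admissible W mu D Gamma u -> admissible W mu' D' Gamma' u' ->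
     eq_on W (photoacoustic_data mu Gamma u) (photoacoustic_data mu' Gamma' u') ->
     (exists x, W x /\ u x = u' x) ->
     mu = mu' \/ D = D' \/ Gamma = Gamma' ->
     (mu, D, Gamma) = (mu', D', Gamma'))
  /\
  (* (c) *)
  (forall (mu D Gamma : R) (u : 'rV[R]_3 -> R),
     admissible W mu D Gamma u ->
     let not_determined_by
           (same_known : R -> R -> R -> ('rV[R]_3 -> R) -> Prop) :=
       exists (mu' D' Gamma' : R) (u' : 'rV[R]_3 -> R),
         [/\ admissible W mu' D' Gamma' u',
             eq_on W (photoacoustic_data mu Gamma u)
                     (photoacoustic_data mu' Gamma' u'),
             same_known mu' D' Gamma' u'
           & (mu', D', Gamma') <> (mu, D, Gamma)] in
     [/\ not_determined_by (fun mu' D' Gamma' u' => mu' = mu),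
         not_determined_by (fun mu' D' Gamma' u' => D' = D),
         not_determined_by (fun mu' D' Gamma' u' => Gamma' = Gamma),
         not_determined_by (fun mu' D' Gamma' u' => eq_on W u' u)
       & not_determined_by (fun mu' D' Gamma' u' => (mu', D') = (mu, D))]).
Proof.
have Wopen := W_domain.1.
split; [|split].
- move=> mu D G u mu' D' G' u' A A' H known.
  have mu0 := lt0r_neq0 (absorption_gt0 A); have D0 := lt0r_neq0 (diffusion_gt0 A).
  have ratio := same_data_ratio Wopen W_neq0 A A' H.
  case: known => -[E EG]; rewrite -E in ratio *.
    by rewrite EG (mulfI mu0 ratio).
  by rewrite EG (mulIf D0 ratio).
- move=> mu D G u mu' D' G' u' A A' H [x [Wx ux]] known.
  have mu0 := lt0r_neq0 (absorption_gt0 A); have D0 := lt0r_neq0 (diffusion_gt0 A).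
  have G0 := lt0r_neq0 (gruneisen_gt0 A).
  have ratio := same_data_ratio Wopen W_neq0 A A' H.
  (* At the point where the fluences agree, their common positive value cancels from the data. *)
  have prod : G * mu = G' * mu'.
    apply: (mulIf (lt0r_neq0 (fluence_gt0 A Wx))).
    by rewrite [RHS]/(_ * _) {2}ux; exact: H.
  (* [mu] occurs in both [ratio] and [prod], so it determines [D] and [G]; a known [D] or [G] first
     yields [mu] through one of them. *)
  have muD : mu = mu' -> (mu, D, G) = (mu', D', G').
    move=> Emu; rewrite -Emu in ratio prod *.
    by rewrite (mulfI mu0 ratio) (mulIf mu0 prod).
  case: known => [//|[ED|EG]]; apply: muD.
    by rewrite -ED in ratio; exact: mulIf ratio.
  by rewrite -EG in prod; exact: mulfI prod.
- move=> mu D G u A not_determined_by.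
  have [mu0 D0 G0] := And3 (absorption_gt0 A) (diffusion_gt0 A) (gruneisen_gt0 A).
  have two0 : 0 < 2 :> R by [].
  have half0 : 0 < 2^-1 :> R by rewrite invr_gt0.
  (* The data are multiplied by [a * b * c], so the condition [a * b * c = 1] preserves them. *)
  have rescale (a b c : R) (P : R -> R -> R -> ('rV[R]_3 -> R) -> Prop) :
      0 < a -> 0 < b -> 0 < c -> a * b * c = 1 -> a * mu != mu \/ b * G != G ->
      P (a * mu) (a * D) (b * G) (fun x => c * u x) -> not_determined_by P.
    move=> a0 b0 c0 abc neq known.
    exists (a * mu), (a * D), (b * G), (fun x => c * u x); split => //.
    - exact: admissible_scale.
    - by move=> x _; rewrite /photoacoustic_data -[LHS]mul1r -abc; ring.
    - by case=> Emu _ EG; case: neq; rewrite ?Emu ?EG eqxx.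
  have double (x : R) : 0 < x -> 2 * x != x.
    by move=> x0; apply/eqP; lra.
  (* Doubling [G] and halving [u] fixes both [mu] and [D], which serves three of the five cases. *)
  have double_G (P : R -> R -> R -> ('rV[R]_3 -> R) -> Prop) :
      P (1 * mu) (1 * D) (2 * G) (fun x => 2^-1 * u x) -> not_determined_by P.
    apply: rescale => //; first by rewrite mul1r divff.
    by right; exact: double.
  split.
  - by apply: double_G; rewrite mul1r.
  - by apply: double_G; rewrite mul1r.
  (* With [G] fixed, the doubling of [mu] and [D] is absorbed by [u]; with [u] fixed, in the next
     case, by [G]. *)
  - apply: (rescale 2 1 2^-1) => //; last by rewrite mul1r.
      by rewrite mulr1 divff.
    by left; exact: double.
  - apply: (rescale 2 2^-1 1) => //; last by move=> x _; rewrite mul1r.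
      by rewrite divff // mulr1.
    by left; exact: double.
  - by apply: double_G; rewrite !mul1r.
Qed.
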